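(* Let $A$ be an integral domain which is $t$-locally $v$-coherent (i.e. $A_{\mathfrak m}$ is $v$-coherent for each $\mathfrak m\in t\text{-}\mathrm{Max}(A)$). Then the following conditions are equivalent. (i) $A$ has the $t$-finite character. (ii) For every nonzero $a\in A$, every $t$-comaximal collection over $a$ of $t$-finite $t$-ideals of $A$ is finite. (iii) Every nonzero $t$-locally $t$-finite ideal $I$ of $A$ (i.e. such that for every $\mathfrak m\in t\text{-}\mathrm{Max}(A)$ the ideal $IA_{\mathfrak m}$ is $t$-finite with respect to the $t$-operation of $A_{\mathfrak m}$) is $t$-finite.
   Context: Let $A$ be an integral domain with quotient field $K$. ''Ideal'' means integral ideal. For a nonzero fractional ideal $I$, $I^{-1}=(A:I)=\{x\in K: xI\subseteq A\}$, $I^v=(I^{-1})^{-1}$, and $I^t=\bigcup\{J^v: J\subseteq I,\ J \text{ nonzero finitely generated}\}$. $I$ is a $t$-ideal if $I^t=I$; $I$ is $t$-finite if there is a finitely generated $J$ with $J^t=I^t$. $t\text{-}\mathrm{Max}(A)$ is the set of $t$-maximal ideals, i.e. the maximal elements of the set of proper (nonzero, integral) $t$-ideals; they are prime and every proper $t$-ideal is contained in one. $A$ has the $t$-finite character if each nonzero element of $A$ is contained in only finitely many $t$-maximal ideals. For $0\ne a\in A$, a set $\mathscr F$ of ideals of $A$ is a $t$-comaximal collection over $a$ if $a$ belongs to every member of $\mathscr F$ and $(\mathfrak a_1+\mathfrak a_2)^t=A$ for all distinct $\mathfrak a_1,\mathfrak a_2\in\mathscr F$. A domain $A$ is $v$-coherent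 if for every nonzero finitely generated ideal $I$ of $A$ there is a nonzero finitely generated fractional ideal $J$ with $I^{-1}=J^v$. *)

(* Defs.v *)
From HB Require Import structures.
From mathcomp Require Import all_boot all_order all_algebra.
From mathcomp Require Import all_classical.
Set Implicit Arguments.
Unset Strict Implicit.
Unset Printing Implicit Defensive.
Import GRing.Theory.
Local Open Scope ring_scope.
Local Open Scope classical_set_scope.

(** A domain [A], its localizations [A_m] and their (fractional) ideals all
    live in the quotient field [K] of [A], as subsets of [K].  The definitions
    of this section take the base ring as a parameter [D : set K], to be
    instantiated with [A] and with the [A_m]; they are meaningful when [D] is a
    subring of [K] with quotient field [K]. *)
Section StarOperations.
Variable K : fieldType.
Implicit Types (D I J M X : set K) (F : set (set K)).

Definition submodule D I : Prop :=
  [/\ I 0,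
      forall x y, I x -> I y -> I (x + y)
    & forall c x, D c -> I x -> I (c * x)].

Definition ideal D I : Prop := submodule D I /\ I `<=` D.

Definition fractional_ideal D I : Prop :=
  submodule D I /\ exists d, [/\ D d, d != 0 & forall x, I x -> D (d * x)].

Definition nonzero I : Prop := I <> [set 0].

Definition gen_submodule D X : set K := smallest (submodule D) X.

Definition fin_gen D I : Prop := exists2 X, finite_set X & I = gen_submodule D X.

Definition ideal_add I J : set K := [set x + y | x in I & y in J].

Definition inv_ideal D I : set K := [set x | forall y, I y -> D (x * y)].

(** [v_closure] and [t_closure] are only applied to nonzero fractional
    ideals. *)
Definition v_closure D I : set K := inv_ideal D (inv_ideal D I).

Definition t_closure D I : set K :=
  \bigcup_(J in [set J | [/\ J `<=` I, nonzero J & fin_gen D J]])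
    v_closure D J.

Definition t_ideal D I : Prop := t_closure D I = I.

Definition t_finite D I : Prop :=
  exists J, [/\ fractional_ideal D J, nonzero J, fin_gen D J
              & t_closure D J = t_closure D I].

Definition proper_t_ideal D I : Prop :=
  [/\ ideal D I, nonzero I, I <> D & t_ideal D I].

Definition t_Max D : set (set K) :=
  [set M | proper_t_ideal D M /\
           forall I, proper_t_ideal D I -> M `<=` I -> I = M].

Definition t_finite_character D : Prop :=
  forall a, D a -> a != 0 -> finite_set [set M | t_Max D M /\ M a].

Definition t_comaximal_over D (a : K) F : Prop :=
  [/\ forall I, F I -> ideal D I,
      forall I, F I -> I a
    & forall I J, F I -> F J -> I <> J -> t_closure D (ideal_add I J) = D].

Definition v_coherent D : Prop :=
  forall I, ideal D I -> nonzero I -> fin_gen D I ->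
    exists J, [/\ fractional_ideal D J, nonzero J, fin_gen D J
                & inv_ideal D I = v_closure D J].

Definition localization D M : set K := [set x / s | x in D & s in D `\` M].

Definition t_locally_v_coherent D : Prop :=
  forall M, t_Max D M -> v_coherent (localization D M).

(** [gen_submodule (localization D M) I] is the extended ideal [I A_M]. *)
Definition t_locally_t_finite D I : Prop :=
  forall M, t_Max D M ->
    t_finite (localization D M) (gen_submodule (localization D M) I).

End StarOperations.

Definition dom_in_frac (A : idomainType) : set {fraction A} :=
  range (@tofrac A).

Arguments dom_in_frac A : clear implicits.

(* Main.v *)
(** Write [A_M] for the localizations at the [t]-maximal ideals.

    (i) -> (ii): each proper member of a [t]-comaximal collection over [a] lies
    in some [t]-maximal ideal, and no two members lie in the same one.

    (ii) -> (i): call a finite set containing [a] homogeneous if it lies in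
    exactly one [t]-maximal ideal.  A finite set without homogeneous finite
    superset could be split again and again into two [t]-comaximal ones.  So
    every proper finite set over [a] sits in a homogeneous one.  Homogeneous
    sets of distinct [t]-maximal ideals are [t]-comaximal, hence only finitely many
    [M1, ..., Mn] occur; if [M] is another [t]-maximal ideal over [a], choosing
    [xi] in [M] outside [Mi] gives a set [{a, x1, ..., xn}] contained in no
    homogeneous one.

    (i) -> (iii): if [a] in [I] lies only in [M1, ..., Mn], then [a] and finite
    subsets of [I] computing the [t]-closure of [I A_Mi] suffice, since
    [A] is the intersection of the [A_M].

    (iii) -> (ii): let [B] be the sum of the [a I^-1] for [I] in the collection
    [F]. It is [t]-locally [t]-finite, so that [B^t] is the [v]-closure of
    finitely many elements, coming from [I1, ..., In].  If [I] is another
    member, then [a I^-1] lies in this closure, so [I] contains the intersection of the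
    [Ij], and hence a [t]-maximal ideal over [I] contains some [Ij]: [I] is not
    proper. *)
Require Import Defs.
From HB Require Import structures.
From mathcomp Require Import all_boot all_order all_algebra.
From mathcomp Require Import all_classical.
Set Implicit Arguments.
Unset Strict Implicit.
Unset Printing Implicit Defensive.
Import GRing.Theory.
Local Open Scope ring_scope.
Local Open Scope classical_set_scope.

(** * Finite sets: common witnesses, chains, images *)

Lemma finite_common (T U : Type) (Y : set T) (X : set U)
    (Q : T -> set U -> Prop) :
  finite_set Y ->
  (forall y Z Z', Z `<=` Z' -> Q y Z -> Q y Z') ->
  (forall y, Y y -> exists Z, [/\ finite_set Z, Z `<=` X & Q y Z]) ->
  exists Z, [/\ finite_set Z, Z `<=` X & forall y, Y y -> Q y Z].
Proof.
move=> finY Qmono hQ.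
have /choice[f hf] : forall y, exists Z,
    Y y -> [/\ finite_set Z, Z `<=` X & Q y Z].
  move=> y; have [/hQ[Z hZ]|nYy] := pselect (Y y); first by exists Z.
  by exists set0.
exists (\bigcup_(y in Y) f y); split.
- by apply: bigcup_finite => // y /hf[].
- by move=> u [y /hf[_ + _]]; apply.
- move=> y Yy; have [_ _] := hf y Yy.
  by apply: Qmono => u fyu; exists y.
Qed.

(** Gives the chain condition in Zorn's lemma for [t_Max_exists]. The left alternative covers the
    empty chain. *)
Lemma finite_sub_chain (T : eqType) (Y X : set T) (C : set (set T)) :
  total_on C subset -> finite_set Y -> Y `<=` X `|` \bigcup_(M in C) M ->
  Y `<=` X \/ exists2 M, C M & Y `<=` X `|` M.
Proof.
move=> Ctot /finite_seqP[s ->] {Y}; elim: s => [|y s IH] sub; first by left.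
have [|sX|[M CM sM]] := IH.
- by move=> z /= zs; apply: sub => /=; rewrite inE zs orbT.
- have [Xy|[M CM My]] := sub y (mem_head _ _).
    by left => z /=; rewrite inE => /orP[/eqP->|/sX].
  by right; exists M => // z /=; rewrite inE => /orP[/eqP->|/sX]; [right|left].
- right; have [Xy|[N CN Ny]] := sub y (mem_head _ _).
    by exists M => // z /=; rewrite inE => /orP[/eqP->|/sM]; [left|].
  have [MN|NM] := Ctot _ _ CM CN.
    exists N => // z /=; rewrite inE => /orP[/eqP->|/sM[]]; first by right.
      by left.
    by move/MN; right.
  exists M => // z /=; rewrite inE => /orP[/eqP->|/sM//].
  by right; apply: NM.
Qed.

Lemma finite_of_image (T U : Type) (B : set T) (f : T -> U) :
  (forall x y, B x -> B y -> f x = f y -> x = y) ->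
  finite_set (f @` B) -> finite_set B.
Proof.
move=> finj; rewrite (@eq_finite_set _ _ _ B)//; apply: inj_card_eq.
by move=> x y; rewrite !inE; apply: finj.
Qed.

(** * The $v$- and $t$-closures and the $t$-maximal ideals of one subring *)

Section Closures.
Variables (K : fieldType) (D : set K).
Implicit Types (I J X Y Z : set K) (x y z w : K).

Lemma inv_ideal_sub X Y : X `<=` Y -> inv_ideal D Y `<=` inv_ideal D X.
Proof. by move=> XY w wY y /XY/wY. Qed.

Lemma sub_v_closure X : X `<=` v_closure D X.
Proof. by move=> x Xx w wX; rewrite mulrC; apply: wX. Qed.

Lemma v_closure_sub X Y : X `<=` Y -> v_closure D X `<=` v_closure D Y.
Proof. by move=> XY; apply/inv_ideal_sub/inv_ideal_sub. Qed.

Lemma inv_v_closure X : inv_ideal D (v_closure D X) = inv_ideal D X.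
Proof.
apply/seteqP; split; first exact/inv_ideal_sub/sub_v_closure.
exact: sub_v_closure.
Qed.

Lemma v_closure_le X Y :
  X `<=` v_closure D Y -> v_closure D X `<=` v_closure D Y.
Proof. by move/v_closure_sub; rewrite {2}/v_closure inv_v_closure. Qed.

(* Working with the [t]-closure of arbitrary sets, rather than of nonzero
   submodules only, removes all finite generation bookkeeping. *)
Definition tcl X : set K :=
  [set x | exists Y, [/\ finite_set Y, Y `<=` X & v_closure D Y x]].

Lemma tcl_sub X Y : X `<=` Y -> tcl X `<=` tcl Y.
Proof.
by move=> XY x [Z [finZ ZX vx]]; exists Z; split=> //; apply: subset_trans XY.
Qed.

Lemma tcl_finite X : finite_set X -> tcl X = v_closure D X.
Proof.
move=> finX; apply/seteqP; split=> x; last by move=> vx; exists X; split.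
by move=> [Y [_ /v_closure_sub YX /YX]].
Qed.

Lemma sub_tcl X : X `<=` tcl X.
Proof.
move=> x Xx; exists [set x]; split; [exact: finite_set1|by move=> _ ->|].
exact: sub_v_closure.
Qed.

Lemma finite_sub_tcl X Y : finite_set Y -> Y `<=` tcl X ->
  exists Z, [/\ finite_set Z, Z `<=` X & Y `<=` v_closure D Z].
Proof.
move=> finY; apply: (finite_common (Q := fun y Z => v_closure D Z y)) finY _.
by move=> y Z Z' /v_closure_sub; apply.
Qed.

Lemma tcl_le X Y : X `<=` tcl Y -> tcl X `<=` tcl Y.
Proof.
move=> XY x [Z [finZ ZX vx]].
have [W [finW WY ZW]] := finite_sub_tcl finZ (subset_trans ZX XY).
by exists W; split=> //; apply: v_closure_le vx.
Qed.

Lemma tcl_scale a X x : tcl X x -> tcl ( *%R a @` X) (a * x).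
Proof.
move=> [Y [finY YX vx]]; exists ( *%R a @` Y); split.
- exact: finite_image.
- exact: image_subset.
- move=> u uaY; rewrite mulrAC mulrC; apply: vx => y Yy.
  by rewrite -mulrA mulrCA; apply: uaY; exists y.
Qed.

Hypothesis Dmod : submodule D D.

Lemma mem_mul x y : D x -> D y -> D (x * y).
Proof. by case: Dmod => _ _; apply. Qed.

Lemma submodule_inv X : submodule D (inv_ideal D X).
Proof.
have [D0 DD DM] := Dmod; split.
- by move=> y _; rewrite mul0r.
- by move=> x y hx hy z Xz; rewrite mulrDl; apply: DD; [apply: hx|apply: hy].
- by move=> c x Dc hx z Xz; rewrite -mulrA; apply: DM => //; apply: hx.
Qed.

Lemma submodule_gen X : submodule D (gen_submodule D X).
Proof.
split=> [I [[]]//|x y hx hy I hI|c x Dc hx I hI].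
- by case: (hI) => -[_ + _] _; apply; [apply: hx|apply: hy].
- by case: (hI) => -[_ _ +] _; apply=> //; apply: hx.
Qed.

(** For fixed [w], the elements that [w] multiplies into [D] form a submodule. Hence generators may
    replace finitely generated ideals in inverses and $v$-closures. *)
Lemma inv_gen X : inv_ideal D (gen_submodule D X) = inv_ideal D X.
Proof.
have [D0 DD DM] := Dmod.
apply/seteqP; split; first by apply: inv_ideal_sub; exact: sub_gen_smallest.
move=> w wX y; apply: (smallest_sub (X := [set y | D (w * y)])) => {y}//.
split=> /= [|x y|c x Dc wx]; first by rewrite mulr0.
  by rewrite mulrDr; apply: DD.
by rewrite mulrCA; apply: DM.
Qed.

Lemma submodule_tcl X : submodule D (tcl X).
Proof.
split.
- by exists set0; split=> //; case: (submodule_inv (inv_ideal D set0)).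
- move=> x y [Y [finY YX vx]] [Z [finZ ZX vy]].
  exists (Y `|` Z); split; first by rewrite finite_setU.
    by move=> u [/YX|/ZX].
  have [_ + _] := submodule_inv (inv_ideal D (Y `|` Z)); apply.
    by apply: v_closure_sub vx => u; left.
  by apply: v_closure_sub vy => u; right.
- move=> c x Dc [Y [finY YX vx]]; exists Y; split=> //.
  by have [_ _] := submodule_inv (inv_ideal D Y); apply.
Qed.

Lemma tcl_gen X : tcl (gen_submodule D X) = tcl X.
Proof.
apply/seteqP; split; last by apply: tcl_sub; exact: sub_gen_smallest.
by apply: tcl_le; apply: smallest_sub; [exact: submodule_tcl|exact: sub_tcl].
Qed.

Lemma gen_id I : submodule D I -> gen_submodule D I = I.
Proof.
by move=> ?; apply/seteqP; split; [exact: smallest_sub|exact: sub_gen_smallest].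
Qed.

Lemma nonzeroP I : I 0 -> nonzero I <-> exists2 x, I x & x != 0.
Proof.
move=> I0; split=> [nzI|[x Ix /eqP x0 I_0]].
  apply: contra_notP nzI => nI; apply/seteqP; split=> x /= => [Ix|->//].
  by apply/eqP/negPn/negP => x0; apply: nI; exists x.
by apply: x0; have : [set 0] x by rewrite -I_0.
Qed.

Lemma nonzero_gen X : nonzero (gen_submodule D X) <-> exists2 x, X x & x != 0.
Proof.
have [g0 _ _] := submodule_gen X; rewrite (nonzeroP g0).
split=> -[x Xx x0]; last by exists x => //; apply: sub_gen_smallest.
apply: contrapT => nX; move/negP: x0; apply; apply/eqP.
suff : gen_submodule D X `<=` [set 0] by apply.
apply: smallest_sub => [|y Xy /=]; last first.
  by apply/eqP/negPn/negP => y0; apply: nX; exists y.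
split=> //.
- by move=> y z -> ->; rewrite addr0.
- by move=> c y _ ->; rewrite mulr0.
Qed.

Lemma t_closureE I : submodule D I -> nonzero I -> t_closure D I = tcl I.
Proof.
move=> Imod nzI; have [I0 _ _] := Imod; apply/seteqP; split=> x.
  move=> [J [JI nzJ [Y finY JE]]] /=; rewrite JE /v_closure inv_gen => vx.
  exists Y; split=> //; apply: subset_trans JI.
  by rewrite JE; apply: sub_gen_smallest.
move=> [Y [finY YI vx]]; have /(nonzeroP I0)[y Iy y0] := nzI.
(* [t_closure] ranges over nonzero submodules only, so the nonzero [y] is adjoined to [Y]. *)
exists (gen_submodule D (y |` Y)); last first.
  by rewrite /v_closure inv_gen; apply: v_closure_sub vx => z; right.
have yYI : y |` Y `<=` I by move=> z [->|/YI].
split; first exact: smallest_sub.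
  by apply/nonzero_gen; exists y => //; left.
by exists (y |` Y) => //; rewrite finite_setU; split=> //; apply: finite_set1.
Qed.

(** The given generators [Z] need not lie in [X], but each lies in the $v$-closure of a finite part
    of [X]; the union of these parts serves as [Y]. *)
Lemma t_finite_witness X : (exists2 x, X x & x != 0) ->
  t_finite D (gen_submodule D X) ->
  exists Y, [/\ finite_set Y, Y `<=` X & tcl X `<=` v_closure D Y].
Proof.
move=> hX [J [[Jmod _] nzJ [Z finZ JE] tE]].
move: tE; rewrite !t_closureE //; last exact/nonzero_gen; last first.
  exact: submodule_gen.
rewrite JE !tcl_gen tcl_finite// => tE.
have [|Y [finY YX ZY]] := @finite_sub_tcl X Z finZ.
  by rewrite -tE; apply: sub_v_closure.
by exists Y; split=> //; rewrite -tE; apply: v_closure_le.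
Qed.

Hypothesis D1 : D 1.

Lemma inv_ideal_base : inv_ideal D D = D.
Proof.
apply/seteqP; split=> x; first by move/(_ _ D1); rewrite mulr1.
by move=> Dx y; apply: mem_mul.
Qed.

Lemma v_closure_integral X : X `<=` D -> v_closure D X `<=` D.
Proof. by move/v_closure_sub; rewrite /v_closure !inv_ideal_base. Qed.

Lemma tcl_integral X : X `<=` D -> tcl X `<=` D.
Proof.
by move=> XD x [Y [_ YX]]; apply: v_closure_integral; apply: subset_trans XD.
Qed.

Lemma ideal_tcl X : X `<=` D -> ideal D (tcl X).
Proof. by move=> XD; split; [apply: submodule_tcl|apply: tcl_integral]. Qed.

Lemma tcl1 X : X `<=` D -> tcl X 1 -> tcl X = D.
Proof.
move=> XD X1; apply/seteqP; split; first exact: tcl_integral.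
by move=> x Dx; have [_ _ /(_ x 1 Dx X1)] := submodule_tcl X; rewrite mulr1.
Qed.

Lemma t_finite_intro I Y : submodule D I -> nonzero I -> finite_set Y ->
  Y `<=` D -> (exists2 y, Y y & y != 0) -> tcl I = v_closure D Y ->
  t_finite D I.
Proof.
move=> Imod nzI finY YD hY IY; exists (gen_submodule D Y).
have gmod := submodule_gen Y; have nzY := (nonzero_gen Y).2 hY; split=> //.
- split=> //; exists 1; split; rewrite ?oner_eq0// => x.
  by rewrite mul1r; apply: smallest_sub x.
- by exists Y.
- by rewrite !t_closureE// tcl_gen tcl_finite.
Qed.

Lemma t_finite_t_ideal I : ideal D I -> nonzero I -> t_finite D I ->
  t_ideal D I ->
  exists Y, [/\ finite_set Y, Y `<=` I, exists2 y, Y y & y != 0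
               & I = v_closure D Y].
Proof.
move=> [Imod ID] nzI tfI tI; have [I0 _ _] := Imod.
have hI := (nonzeroP I0).1 nzI; have [x Ix x0] := hI.
have [||Y [finY YI IY]] := @t_finite_witness I; rewrite ?gen_id//.
have tclI : tcl I = I by rewrite -t_closureE.
have xYI : x |` Y `<=` I by move=> y [->|/YI].
have finxY : finite_set (x |` Y).
  by rewrite finite_setU; split=> //; apply: finite_set1.
exists (x |` Y); split=> //; first by exists x => //; left.
apply/seteqP; split.
  by rewrite -{1}tclI; apply: subset_trans IY _; apply: v_closure_sub => y; right.
by rewrite -tcl_finite// -[X in _ `<=` X]tclI; apply: tcl_sub.
Qed.

Lemma ideal_addE I J : ideal D I -> nonzero I -> ideal D J ->
  t_closure D (ideal_add I J) = D <-> tcl (I `|` J) 1.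
Proof.
move=> [[I0 IDD IM] ID] nzI [[J0 JDD JM] JD].
have [D0 DD DM] := Dmod.
have IJ : I `|` J `<=` ideal_add I J.
  move=> x [Ix|Jx]; first by exists x => //; exists 0; rewrite ?addr0.
  by exists 0 => //; exists x; rewrite ?add0r.
have smod : submodule D (ideal_add I J).
  split; first by apply: IJ; left.
    move=> _ _ [x Ix [y Jy <-]] [x' Ix' [y' Jy' <-]].
    by exists (x + x'); [exact: IDD|exists (y + y'); [exact: JDD|rewrite addrACA]].
  move=> c _ Dc [x Ix [y Jy <-]].
  by exists (c * x); [exact: IM|exists (c * y); [exact: JM|rewrite mulrDr]].
have nzs : nonzero (ideal_add I J).
  have [x Ix x0] := (nonzeroP I0).1 nzI.
  by apply/nonzeroP; [case: smod|exists x => //; apply: IJ; left].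
have IJD : I `|` J `<=` D by move=> x [/ID|/JD].
rewrite t_closureE//; have -> : tcl (ideal_add I J) = tcl (I `|` J).
  apply/seteqP; split; last exact: tcl_sub.
  apply: tcl_le => _ [x Ix [y Jy <-]].
  have [_ + _] := submodule_tcl (I `|` J); apply.
    by apply: sub_tcl; left.
  by apply: sub_tcl; right.
by split=> [->//|]; apply: tcl1.
Qed.

Lemma t_MaxP M : t_Max D M ->
  [/\ ideal D M, nonzero M, ~ M 1, tcl M = M &
      forall x, D x -> ~ M x -> tcl (x |` M) 1].
Proof.
move=> [[[Mmod MD] nzM MnD tM] Mmax].
have tclM : tcl M = M by rewrite -t_closureE.
have M1 : ~ M 1.
  by move=> M1; apply: MnD; rewrite -tclM; apply: tcl1; rewrite ?tclM.
split=> // x Dx nMx; apply: contrapT => n1.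
have xMD : x |` M `<=` D by move=> y [->|/MD].
have sub : M `<=` tcl (x |` M) by move=> y My; apply: sub_tcl; right.
have [tmod tD] := ideal_tcl xMD; have [M0 _ _] := Mmod.
have [y My y0] := (nonzeroP M0).1 nzM.
have nzt : nonzero (tcl (x |` M)).
  by apply/nonzeroP; [case: tmod|exists y => //; apply: sub].
apply: nMx; rewrite -(Mmax (tcl (x |` M))) //; first by apply: sub_tcl; left.
split=> //; first by move=> tE; apply: n1; rewrite tE.
rewrite /t_ideal t_closureE//; apply/seteqP; split; last exact: sub_tcl.
exact: tcl_le.
Qed.

Lemma t_Max_prime M x y : t_Max D M -> D x -> D y -> ~ M x -> ~ M y ->
  ~ M (x * y).
Proof.
move=> /t_MaxP[[[_ _ MM] MD] _ _ tclM Mmax] Dx Dy nMx nMy Mxy; apply: nMy.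
have := tcl_scale y (Mmax x Dx nMx); rewrite mulr1 -{2}tclM.
apply: tcl_sub => _ [z [->|Mz] <-]; first by rewrite mulrC.
exact: MM.
Qed.

Lemma t_Max_exists X : X `<=` D -> (exists2 x, X x & x != 0) -> ~ tcl X 1 ->
  exists2 M, t_Max D M & X `<=` M.
Proof.
move=> XD [x Xx x0] nX.
(* Zorn runs over plain subsets, not ideals containing [X], so that the empty union qualifies. A
   maximal [M] equals [tcl (X]|[M)], so it is a $t$-ideal containing [X]. *)
pose P M := M `<=` D /\ ~ tcl (X `|` M) 1.
have [C CP Ctot|M [[MD nM] Mmax]] := @Zorn_bigcup K P.
  split; first by move=> y [M /CP[MD _]]; apply: MD.
  move=> [Y [finY YX v1]]; have [YX'|[M CM YM]] := finite_sub_chain Ctot finY YX.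
    by apply: nX; exists Y.
  by have [_] := CP M CM; apply; exists Y.
have Mmax' N : M `<=` N -> P N -> N = M.
  move=> MN PN; apply: contrapT => NM; apply: (Mmax N) => //; split=> // NM'.
  by apply: NM; apply/seteqP.
have XMD : X `|` M `<=` D by move=> z [/XD|/MD].
have tclM : tcl (X `|` M) = M.
  apply: Mmax'; first by move=> z Mz; apply: sub_tcl; right.
  split; first exact: tcl_integral.
  apply: contra_not nM; apply: tcl_le => z [Xz|//].
  by apply: sub_tcl; left.
have XM : X `<=` M by move=> z Xz; rewrite -tclM; apply: sub_tcl; left.
have {}tclM : tcl M = M by rewrite -{2}tclM; congr tcl; apply/esym/setUidr.
have M1 : ~ M 1 by move: nM; rewrite setUidr// tclM.
have Mmod : submodule D M by rewrite -tclM; apply: submodule_tcl.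
have nzM : nonzero M by apply/nonzeroP; [case: Mmod|exists x => //; apply: XM].
exists M => //; split.
  split=> //; first by move=> ME; apply: M1; rewrite ME.
  by rewrite /t_ideal t_closureE.
move=> I [[Imod ID] nzI InD tI] MI; apply: Mmax' => //; split=> //.
rewrite (setUidr (subset_trans XM MI)) -t_closureE// tI => I1.
apply: InD; apply/seteqP; split=> // z Dz; have [_ _ IM] := Imod.
by rewrite -[z]mulr1; apply: IM.
Qed.

Lemma tcl_id X : tcl (tcl X) = tcl X.
Proof. by apply/seteqP; split; [apply: tcl_le|apply: sub_tcl]. Qed.

Lemma comaximal_t_Max X M : t_Max D M -> tcl X 1 -> ~ X `<=` M.
Proof.
move=> /t_MaxP[_ _ M1 tclM _] X1 XM; apply: M1.
by rewrite -tclM; apply: tcl_sub X1.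
Qed.

Lemma t_Max_incl M N : t_Max D M -> t_Max D N -> M `<=` N -> M = N.
Proof. by move=> [_ maxM] [hN _] MN; apply/esym/maxM. Qed.

End Closures.

(** * Localization at a $t$-maximal ideal *)

Section Localization.
Variables (K : fieldType) (D : set K).
Hypotheses (Dmod : submodule D D) (D1 : D 1).
Implicit Types (I J X Y Z : set K) (x y z w : K).

Section AtPrime.
Variable M : set K.
Hypothesis Mmax : t_Max D M.
Local Notation R := (localization D M).

Lemma t_Max_neq0 s : ~ M s -> s != 0.
Proof.
have [[[M0 _ _] _] _ _ _ _] := t_MaxP Dmod D1 Mmax.
by apply: contra_not_neq => ->.
Qed.

Lemma locP x : R x <-> exists2 s, D s /\ ~ M s & D (s * x).
Proof.
split=> [[y Dy [s [Ds Ms] <-]]|[s [Ds Ms] Dsx]].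
  by exists s => //; rewrite mulrCA divff ?mulr1// t_Max_neq0.
exists (s * x) => //; exists s => //.
by rewrite mulrAC divff ?mul1r// t_Max_neq0.
Qed.

Lemma sub_loc : D `<=` R.
Proof.
have [_ _ M1 _ _] := t_MaxP Dmod D1 Mmax.
by move=> x Dx; apply/locP; exists 1 => //; rewrite mul1r.
Qed.

Lemma submodule_loc : submodule R R.
Proof.
have [D0 DD DM] := Dmod; split; first exact: sub_loc.
  move=> x y /locP[s [Ds Ms] Dsx] /locP[t [Dt Mt] Dty].
  apply/locP; exists (s * t).
    by split; [apply: DM|apply: (t_Max_prime Dmod D1 Mmax)].
  by rewrite mulrDr {1}(mulrC s) -!mulrA; apply: DD; apply: DM.
move=> x y /locP[s [Ds Ms] Dsx] /locP[t [Dt Mt] Dty].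
apply/locP; exists (s * t).
  by split; [apply: DM|apply: (t_Max_prime Dmod D1 Mmax)].
by rewrite mulrACA; apply: DM.
Qed.

Lemma inv_loc_sub X s w : D s -> ~ M s -> inv_ideal D X (s * w) ->
  inv_ideal R X w.
Proof.
by move=> Ds Ms sw x Xx; apply/locP; exists s => //; rewrite mulrA; apply: sw.
Qed.

(** Only finitely many denominators occur, and their product avoids the prime [M]. *)
Lemma inv_loc Y w : finite_set Y -> inv_ideal R Y w ->
  exists2 s, D s /\ ~ M s & inv_ideal D Y (s * w).
Proof.
move=> /finite_seqP[r ->] {Y}; elim: r => [|y r IH] hw.
  have [_ _ M1 _ _] := t_MaxP Dmod D1 Mmax.
  by exists 1.
have [|s [Ds Ms] sw] := IH.
  by move=> z /= zr; apply: hw => /=; rewrite inE zr orbT.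
have /locP[t [Dt Mt] Dty] : R (w * y) by apply: hw => /=; rewrite mem_head.
have [D0 DD DM] := Dmod; exists (s * t).
  by split; [apply: DM|apply: (t_Max_prime Dmod D1 Mmax)].
move=> z /=; rewrite inE => /orP[/eqP->|zr].
  by rewrite -!mulrA; apply: DM.
by rewrite (mulrC s) -!mulrA; apply: DM => //; rewrite mulrA; apply: sw.
Qed.

End AtPrime.

(** The denominators of [w] form an inverse [C], which is its own $v$-closure. If 1 is in [tcl D C],
    it is in [C] and [w] is in [D]; otherwise [C] lies in some [M], although [w] has a denominator
    outside [M]. *)
Lemma loc_integral w :
  (forall z, exists2 s, D s /\ s != 0 & D (s * z)) ->
  (forall M, t_Max D M -> localization D M w) -> D w.
Proof.
move=> fracD locw.
pose C := inv_ideal D [set 1; w].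
have CD : C `<=` D by move=> c Cc; rewrite -[c]mulr1; apply: Cc; left.
have [s [Ds s0] Dsw] := fracD w.
have Cs : C s by move=> _ [->|->] //; rewrite mulr1.
have vC : v_closure D C = C by rewrite /v_closure /C inv_v_closure.
have [[Y [_ YC v1]]|nC] := pselect (tcl D C 1).
  suff : C 1 by move=> /(_ w); rewrite mul1r; apply; right.
  by rewrite -vC; apply: v_closure_sub v1.
have [|M Mmax CM] := t_Max_exists Dmod D1 CD _ nC; first by exists s.
have /(locP Mmax)[t [Dt Mt] Dtw] := locw M Mmax.
by case: Mt; apply: CM => _ [->|->] //; rewrite mulr1.
Qed.

End Localization.

(** * Consequences of the $t$-finite character *)

Section Equivalence.
Variables (K : fieldType) (D : set K).
Hypotheses (Dmod : submodule D D) (D1 : D 1).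
Implicit Types (I J M N X Y Z : set K) (F : set (set K)) (x y z w a : K).

(** Condition (ii) at a single [a]: the passage to finitely many $t$-maximal ideals over [a] keeps
    [a] fixed. *)
Definition comaximal_families_finite a :=
  forall F, t_comaximal_over D a F ->
    (forall I, F I -> t_finite D I /\ t_ideal D I) -> finite_set F.

Lemma comaximal_member a F I : a != 0 -> t_comaximal_over D a F -> F I ->
  t_ideal D I ->
  [/\ ideal D I, nonzero I, tcl D I = I & I <> D -> ~ I 1].
Proof.
move=> a0 [Fid Fa _] FI tI; have idI := Fid I FI.
have [[I0 IDD IM] ID] := idI.
have nzI : nonzero I by apply/(nonzeroP I0); exists a => //; apply: Fa.
have tclI : tcl D I = I by rewrite -t_closureE.
by split=> // InD I1; apply: InD; rewrite -tclI; apply: tcl1; rewrite ?tclI.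
Qed.

Lemma comaximal_pair a F I J : a != 0 -> t_comaximal_over D a F ->
  F I -> F J -> I <> J -> tcl D (I `|` J) 1.
Proof.
move=> a0 [Fid Fa Fco] FI FJ IJ.
have [[[I0 _ _] _] idJ] := (Fid I FI, Fid J FJ).
apply/ideal_addE; rewrite ?Fco//; first exact: Fid.
by apply/(nonzeroP I0); exists a => //; apply: Fa.
Qed.

Lemma comaximal_families_finite_of_character a : t_finite_character D ->
  D a -> a != 0 -> comaximal_families_finite a.
Proof.
move=> fchar Da a0 F Fco Ftf.
have /choice[f hf] : forall I, exists M,
    F I -> I <> D -> t_Max D M /\ I `<=` M.
  move=> I; have [[FI InD]|nI] := pselect (F I /\ I <> D); last first.
    by exists set0 => ? ?; case: nI.
  have [_ tI] := Ftf I FI.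
  have [[[I0 _ _] ID] nzI tclI] := comaximal_member a0 Fco FI tI.
  move=> /(_ InD) I1.
  have [|M ? ?] := @t_Max_exists _ _ Dmod D1 _ ID ((nonzeroP I0).1 nzI).
    by rewrite tclI.
  by exists M.
(* A collection may contain [D] itself, which lies in no $t$-maximal ideal. *)
suff finFD : finite_set (F `\ D).
  apply: (@sub_finite_set _ _ (F `\ D `|` [set D])).
    by move=> I FI; have [->|?] := pselect (I = D); [right|left].
  by rewrite finite_setU; split=> //; apply: finite_set1.
apply: (finite_of_image (f := f)) => [I J [FI InD] [FJ JnD] fIJ|].
  apply: contrapT => /(comaximal_pair a0 Fco FI FJ).
  have [Mmax IM] := hf I FI InD; have [_] := hf J FJ JnD; rewrite -fIJ => JM.
  by move=> /(comaximal_t_Max Dmod D1 Mmax); apply=> x [/IM|/JM].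
apply: sub_finite_set (fchar a Da a0) => _ [I [FI InD] <-].
by have [? IM] := hf I FI InD; split=> //; apply: IM; case: Fco => _ + _; apply.
Qed.

Lemma t_finite_of_character I : t_finite_character D ->
  (forall z, exists2 s, D s /\ s != 0 & D (s * z)) ->
  ideal D I -> nonzero I -> t_locally_t_finite D I -> t_finite D I.
Proof.
move=> fchar fracD [Imod ID] nzI locI; have [I0 _ _] := Imod.
have [a Ia a0] := (nonzeroP I0).1 nzI.
have hI : exists2 x, I x & x != 0 by exists a.
have [|//|Y [finY YI IY]] := finite_common (X := I)
  (Q := fun M Y => I `<=` v_closure (localization D M) Y)
  (fchar a (ID _ Ia) a0).
- by move=> M Z Z' ZZ' IZ; apply: subset_trans (v_closure_sub ZZ').
- move=> M [Mmax Ma].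
  have Rmod := submodule_loc Dmod D1 Mmax.
  have [Y [finY YI tY]] := t_finite_witness Rmod hI (locI M Mmax).
  by exists Y; split=> //; apply: subset_trans tY; apply: sub_tcl.
(* Checked at each [M]: where [a] is outside [M] it is a unit of the localization, and at the
   finitely many remaining [M] the set [Y] suffices. *)
have IaY : I `<=` v_closure D (a |` Y).
  move=> x Ix u uY; apply: loc_integral => // M Mmax.
  have [Ma|Ma] := pselect (M a); last first.
    apply/(locP Dmod D1 Mmax); exists a; first by split=> //; apply: ID.
    rewrite mulrCA; apply: (mem_mul Dmod); first exact: ID.
    by rewrite mulrC; apply: uY; left.
  apply: (IY M) => // y Yy; apply: (sub_loc Dmod D1 Mmax).
  by apply: uY; right.
have aYI : a |` Y `<=` I by move=> x [->|/YI].
have finaY : finite_set (a |` Y).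
  by rewrite finite_setU; split=> //; apply: finite_set1.
apply: (t_finite_intro Dmod D1 (Y := a |` Y)) => //.
- exact: subset_trans ID.
- by exists a => //; left.
- rewrite -tcl_finite//; apply/seteqP; split; last exact: tcl_sub.
  by apply: tcl_le; rewrite tcl_finite.
Qed.

(** * From comaximal collections to the $t$-finite character *)

Section FiniteCharacter.
Variable a : K.
Hypotheses (a0 : a != 0) (Hco : comaximal_families_finite a).

(** Such a set stands for the proper $t$-finite $t$-ideal [tcl D X] over [a]. *)
Definition proper_over X := [/\ finite_set X, X `<=` D, X a & ~ tcl D X 1].

(** The closures of the [f i] form a collection as in (ii). Distinct indices have distinct closures,
    since a proper closure is not $t$-comaximal with itself. *)
Lemma finite_proper_family (T : Type) (B : set T) (f : T -> set K) :
  (forall i, B i -> proper_over (f i)) ->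
  (forall i j, B i -> B j -> i <> j -> tcl D (f i `|` f j) 1) ->
  finite_set B.
Proof.
move=> fP fco; apply: (finite_of_image (f := tcl D \o f)) => [i j Bi Bj /= fij|].
  apply: contrapT => /(fco i j Bi Bj); have [_ _ _ n1] := fP i Bi.
  apply: contra_not n1; rewrite -(tcl_id D (f i)); apply: tcl_sub => x [].
    exact: sub_tcl.
  by rewrite fij; apply: sub_tcl.
have nz i : B i -> nonzero (tcl D (f i)).
  move=> Bi; have [t0 _ _] := submodule_tcl Dmod (f i).
  apply/(nonzeroP t0); exists a => //.
  by apply: sub_tcl; have [] := fP i Bi.
apply: Hco; first split.
- by move=> _ [i Bi <-]; apply: ideal_tcl => //; have [] := fP i Bi.
- by move=> _ [i Bi <-]; apply: sub_tcl; have [] := fP i Bi.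
- move=> _ _ [i Bi <-] [j Bj <-] /= ij; apply/ideal_addE => //.
  + by apply: ideal_tcl => //; have [] := fP i Bi.
  + exact: nz.
  + by apply: ideal_tcl => //; have [] := fP j Bj.
  + have : tcl D (f i `|` f j) 1 by apply: fco => // ij'; apply: ij; rewrite ij'.
    apply: tcl_sub => x [fx|fx]; [left|right]; exact: sub_tcl.
- move=> _ [i Bi <-] /=; have [finf fD fa _] := fP i Bi.
  have tmod := submodule_tcl Dmod (f i); split.
    apply: (t_finite_intro Dmod D1 (Y := f i)) => //; first exact: nz.
      by exists a.
    by rewrite tcl_id tcl_finite.
  by rewrite /t_ideal t_closureE// ?tcl_id//; apply: nz.
Qed.

Lemma proper_over_split X M N : proper_over X -> t_Max D M -> t_Max D N ->
  M <> N -> X `<=` M -> X `<=` N ->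
  exists Y Z, [/\ proper_over Y, proper_over Z, X `<=` Y, X `<=` Z
                & tcl D (Y `|` Z) 1].
Proof.
move=> [finX XD Xa nX] Mmax Nmax MN XM XN.
have [x Mx Nx] : exists2 x, M x & ~ N x.
  apply: contrapT => nx; apply: MN; apply: (t_Max_incl Mmax Nmax) => x Mx.
  by apply: contrapT => Nx; apply: nx; exists x.
have [[_ MD] _ _ _ _] := t_MaxP Dmod D1 Mmax.
have [[_ ND] _ _ _ /(_ x (MD _ Mx) Nx)[W [finW WN v1]]] := t_MaxP Dmod D1 Nmax.
have XxM : x |` X `<=` M by move=> y [->|/XM].
have XWN : X `|` (W `&` N) `<=` N by move=> y [/XN|[]].
(* [W] witnesses that [x] and [N] are $t$-comaximal. Its elements other than [x] lie in [N], so [W]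
   is shared between the two sets, one inside [M] and one inside [N]. *)
exists (x |` X), (X `|` (W `&` N)); split.
- split; [|exact: subset_trans MD|by right|].
    by rewrite finite_setU; split=> //; apply: finite_set1.
  by move=> /(comaximal_t_Max Dmod D1 Mmax); apply.
- split; [|exact: subset_trans ND|by left|].
    by rewrite finite_setU; split=> //; apply: finite_setIl.
  by move=> /(comaximal_t_Max Dmod D1 Nmax); apply.
- by move=> y; right.
- by move=> y; left.
- exists W; split=> // y Wy; have [->|Ny] := WN y Wy; first by left; left.
  by right; right.
Qed.

(* Otherwise repeated splitting would produce an infinite sequence of pairwise
   [t]-comaximal finite sets. *)
Lemma in_homogeneous X : proper_over X ->
  exists H M, [/\ X `<=` H, proper_over H, t_Max D M, H `<=` M
                & forall N, t_Max D N -> H `<=` N -> N = M].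
Proof.
move=> PX; apply: contrapT => nohom.
have /choice[g hg] : forall Y, exists p : set K * set K,
    X `<=` Y -> proper_over Y ->
    [/\ proper_over p.1, proper_over p.2, Y `<=` p.1, Y `<=` p.2
      & tcl D (p.1 `|` p.2) 1].
  move=> Y; have [[XY PY]|nY] := pselect (X `<=` Y /\ proper_over Y); last first.
    by exists (set0, set0) => ? ?; case: nY.
  have [_ YD Ya Y1] := PY.
  have [|M Mmax YM] := t_Max_exists Dmod D1 YD _ Y1; first by exists a.
  have [N [Nmax YN NM]] : exists N, [/\ t_Max D N, Y `<=` N & M <> N].
    apply: contrapT => nN; apply: nohom; exists Y, M; split=> // N Nmax YN.
    by apply: contrapT => NM; apply: nN; exists N; split=> //; apply: nesym.
  have [Y1' [Y2 ?]] := proper_over_split PY Mmax Nmax NM YM YN.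
  by exists (Y1', Y2).
(* The second half is split again each time; the first halves form the infinite family. *)
pose x n := iter n (fun Y => (g Y).2) X.
have xP n : X `<=` x n /\ proper_over (x n).
  elim: n => [|n [Xx Px]]; first by split.
  have [_ ? _ xs _] := hg _ Xx Px.
  by split=> //; apply: subset_trans xs.
have xmono m n : (m <= n)%N -> x m `<=` x n.
  move=> /subnK <-; elim: (n - m)%N => [|k IH]; first by [].
  have [Xx Px] := xP (k + m)%N; have [_ _ _ xs _] := hg _ Xx Px.
  exact: subset_trans xs.
(* From [m < n], the set [x m.+1], which is [(g (x m)).2], lies in [x n] and so in [(g (x n)).1]. *)
have xco m n : (m < n)%N -> tcl D ((g (x m)).1 `|` (g (x n)).1) 1.
  move=> /xmono mn.
  have [Xm Pm] := xP m; have [_ _ _ _ co] := hg _ Xm Pm.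
  have [Xn Pn] := xP n; have [_ _ nn _ _] := hg _ Xn Pn.
  by apply: tcl_sub co => y [|/mn/nn]; [left|right].
apply: infinite_nat.
apply: (finite_proper_family (f := fun n => (g (x n)).1)) => [n _|m n _ _ mn].
  by have [Xx Px] := xP n; case: (hg _ Xx Px).
have [/xco//|/xco|//] := ltngtP m n.
by rewrite setUC.
Qed.

Lemma finite_t_Max_over : finite_set [set M | t_Max D M /\ M a].
Proof.
pose B := [set M | t_Max D M /\ exists H,
  [/\ proper_over H, H `<=` M & forall N, t_Max D N -> H `<=` N -> N = M]].
have /choice[f hf] : forall M, exists H, B M ->
    [/\ proper_over H, H `<=` M & forall N, t_Max D N -> H `<=` N -> N = M].
  move=> M; have [[_ [H hH]]|nB] := pselect (B M); first by exists H.
  by exists set0.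
have finB : finite_set B.
  apply: (finite_proper_family (f := f)) => [M /hf[]//|M N BM BN MN].
  have [[_ MD Ma _] _ Muniq] := hf M BM; have [[_ ND _ _] _ Nuniq] := hf N BN.
  apply: contrapT => n1.
  (* A $t$-maximal [L] over both homogeneous sets would have to be [M] and also [N]. *)
  have [||L Lmax sub] := t_Max_exists Dmod D1 _ _ n1.
  - by move=> x [/MD|/ND].
  - by exists a => //; left.
  apply: MN; transitivity L.
    by apply/esym/Muniq => // x fMx; apply: sub; left.
  by apply: Nuniq => // x fNx; apply: sub; right.
apply: (sub_finite_set _ finB) => M [Mmax Ma].
have [[_ MD] _ _ _ _] := t_MaxP Dmod D1 Mmax.
apply: contrapT => nBM.
have [||Z [finZ ZM ZB]] := finite_common (X := M) (Q := fun N Z => ~ Z `<=` N) finB.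
- by move=> N Z Z' ZZ'; apply: contra_not; apply: subset_trans.
- move=> N BN; have [Nmax _] := BN.
  have [x Mx Nx] : exists2 x, M x & ~ N x.
    apply: contrapT => nx; apply: nBM; rewrite (@t_Max_incl _ D M N)// => x Mx.
    by apply: contrapT => Nx; apply: nx; exists x.
  exists [set x]; split; [exact: finite_set1|by move=> _ ->|].
  by apply: contra_not Nx; apply.
have [|H [N [XH PH Nmax HN Nuniq]]] := @in_homogeneous (a |` Z).
  split; [|by move=> x [->|/ZM/MD//]; apply: MD|by left|].
    by rewrite finite_setU; split=> //; apply: finite_set1.
  by move=> /(comaximal_t_Max Dmod D1 Mmax); apply=> x [->|/ZM].
apply: (ZB N); first by split=> //; exists H.
by move=> x Zx; apply/HN/XH; right.
Qed.

End FiniteCharacter.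

(** * The sum of the ideals $a I^{-1}$ and its local $t$-finiteness *)

Definition inv_family a F : set K :=
  [set w | exists I u, [/\ F I, inv_ideal D I u & w = a * u]].

Lemma inv_family_integral a F : t_comaximal_over D a F ->
  inv_family a F `<=` D.
Proof.
move=> [_ Fa _] _ [I [u [FI uI ->]]]; rewrite mulrC.
exact: uI (Fa I FI).
Qed.

Lemma inv_family_mem a F : F !=set0 -> t_comaximal_over D a F ->
  inv_family a F a.
Proof.
move=> [I FI] [Fid _ _]; exists I, 1; split; rewrite ?mulr1// => x Ix.
by rewrite mul1r; have [_] := Fid I FI; apply.
Qed.

(* A [t]-maximal [M] contains at most one [I] in [F]; every other [a J^-1]
   extends to a subset of [a A_M], so that the extension of the family is
   [a I^-1 A_M], to which [v]-coherence applies. *)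
Lemma t_locally_t_finite_inv_family a F : t_locally_v_coherent D ->
  a != 0 -> F !=set0 -> t_comaximal_over D a F ->
  (forall I, F I -> t_finite D I /\ t_ideal D I) ->
  t_locally_t_finite D (gen_submodule D (inv_family a F)).
Proof.
move=> Dcoh a0 Fne Fco Ftf M Mmax.
have Rmod := submodule_loc Dmod D1 Mmax; have DR := sub_loc Dmod D1 Mmax.
set R := localization D M in Rmod DR *.
have R1 : R 1 by apply: DR.
set X := inv_family a F; set B := gen_submodule D X.
have XD : X `<=` D := inv_family_integral Fco.
have Xa : X a := inv_family_mem Fne Fco.
have BX : B `<=` tcl R X.
  apply: smallest_sub; last exact: sub_tcl.
  have [t0 tD tM] := submodule_tcl Rmod X.
  by split=> // c x Dc; apply: tM; apply: DR.
have tclB : tcl R (gen_submodule R B) = tcl R X.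
  rewrite tcl_gen//; apply/seteqP; split; first exact: tcl_le.
  by apply: tcl_sub; apply: sub_gen_smallest.
(* An element of [I] outside [M] serves as a denominator for [u]. *)
have unit_inv I u : F I -> ~ I `<=` M -> inv_ideal D I u -> R u.
  move=> FI IM uI.
  have [s Is Ms] : exists2 s, I s & ~ M s.
    apply: contrapT => ns; apply: IM => x Ix.
    by apply: contrapT => Mx; apply: ns; exists x.
  apply/(locP Dmod D1 Mmax); exists s; last by rewrite mulrC; apply: uI.
  by split=> //; case: Fco => + _ _ => /(_ I FI)[_]; apply.
(* The finite set $aW$ will have the same $t$-closure over [R] as [X]. *)
suff [W [finW [W0 aW] XW]] : exists W, [/\ finite_set W,
    (exists2 w, W w & w != 0) /\ *%R a @` W `<=` tcl R X
    & forall I u, F I -> inv_ideal D I u -> v_closure R W u].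
  have aWv : tcl R X = v_closure R ( *%R a @` W).
    rewrite -tcl_finite; last exact: finite_image.
    apply/seteqP; split; last exact: tcl_le.
    apply: tcl_le => _ [I [u [FI uI ->]]]; apply: tcl_scale.
    by rewrite tcl_finite//; apply: XW uI.
  apply: (t_finite_intro Rmod R1 (Y := *%R a @` W)).
  - exact: submodule_gen.
  - by apply/nonzero_gen => //; exists a => //; apply: sub_gen_smallest.
  - exact: finite_image.
  - apply: (subset_trans aW); apply: tcl_integral => //.
    exact: subset_trans DR.
  - have [w Ww w0] := W0; exists (a * w); first by exists w.
    by rewrite mulf_neq0.
  - by rewrite tclB.
have [[I0 [FI0 I0M]]|nM] := pselect (exists I, F I /\ I `<=` M); last first.
  (* No member lies in [M], so every inverse lies in [R], the $v$-closure of 1. *)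
  exists [set 1]; split; first exact: finite_set1.
    split; first by exists 1; rewrite ?oner_eq0.
    by move=> _ [_ -> <-]; rewrite mulr1; apply: sub_tcl.
  move=> I u FI uI w w1; rewrite mulrC; apply: (mem_mul Rmod).
    by rewrite -[w]mulr1; apply: w1.
  by apply: unit_inv uI => // IM; apply: nM; exists I.
have [tfI0 tI0] := Ftf I0 FI0.
have [idI0 nzI0 tclI0 _] := comaximal_member a0 Fco FI0 tI0.
have [Z [finZ ZI0 hZ I0Z]] := t_finite_t_ideal Dmod idI0 nzI0 tfI0 tI0.
have invI0 : inv_ideal D I0 = inv_ideal D Z by rewrite I0Z inv_v_closure.
have ZR : Z `<=` R by move=> z /ZI0 I0z; apply: DR; case: idI0 => _; apply.
have [|||L [_ nzL [W finW LW] vL]] := Dcoh M Mmax (gen_submodule R Z).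
- by split; [exact: submodule_gen|exact: smallest_sub].
- exact/nonzero_gen.
- by exists Z.
have {}vL : inv_ideal R Z = v_closure R W.
  by move: vL; rewrite inv_gen// LW /v_closure inv_gen.
exists W; split=> //; first split.
- by apply/(nonzero_gen R); rewrite -LW.
- move=> _ [w Ww <-].
  have : inv_ideal R Z w by rewrite vL; apply: sub_v_closure.
  move=> /(inv_loc Dmod D1 Mmax finZ)[s [Ds Ms]]; rewrite -invI0 => sw.
  have [_ _ tM] := submodule_tcl Rmod X.
  (* [s * w] is in the inverse of [I0] over [D], and [s] is a unit of [R]. *)
  rewrite (_ : a * w = s^-1 * (a * (s * w))); last first.
    by rewrite [RHS]mulrCA mulKf// (t_Max_neq0 Dmod D1 Mmax).
  apply: tM; last by apply: sub_tcl; exists I0, (s * w).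
  apply/(locP Dmod D1 Mmax); exists s => //.
  by rewrite divff// (t_Max_neq0 Dmod D1 Mmax).
- move=> I u FI uI; have [II0|II0] := pselect (I = I0).
    rewrite -vL; apply: (inv_loc_sub Dmod D1 Mmax D1).
      by have [] := t_MaxP Dmod D1 Mmax.
    by rewrite mul1r -invI0 -II0.
  have nsub := comaximal_t_Max Dmod D1 Mmax (comaximal_pair a0 Fco FI FI0 II0).
  have Ru : R u.
    by apply: unit_inv uI => // IM; apply: nsub => x [/IM|/I0M].
  rewrite -vL => z Zz; apply: (mem_mul Rmod) => //; exact: ZR.
Qed.

Lemma comaximal_families_finite_of_t_locally a : t_locally_v_coherent D ->
  (forall I, ideal D I -> nonzero I -> t_locally_t_finite D I -> t_finite D I) ->
  a != 0 -> comaximal_families_finite a.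
Proof.
move=> Dcoh hloc a0 F Fco Ftf.
have [F0|/set0P Fne] := eqVneq F set0; first by rewrite F0; apply: finite_set0.
have tlt := t_locally_t_finite_inv_family Dcoh a0 Fne Fco Ftf.
set X := inv_family a F in tlt.
have XD : X `<=` D := inv_family_integral Fco.
have hX : exists2 x, X x & x != 0 by exists a => //; apply: inv_family_mem.
have [|Y [finY YX XY]] := t_finite_witness Dmod hX.
  apply: hloc tlt; last exact/nonzero_gen.
  by split; [exact: submodule_gen|exact: smallest_sub].
have /choice[f hf] : forall y, exists I, Y y ->
    F I /\ exists2 u, inv_ideal D I u & y = a * u.
  move=> y; have [/YX[I [u [FI uI yE]]]|nY] := pselect (Y y); last by exists set0.
  by exists I => _; split=> //; exists u.
(* Every proper member of [F] must be one of those from which the finite set [Y] comes. *)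
apply: (@sub_finite_set _ _ (f @` Y `|` [set D])); last first.
  by rewrite finite_setU; split; [exact: finite_image|exact: finite_set1].
move=> I FI; apply: contrapT => nI.
have [tfI tI] := Ftf I FI.
have [idI nzI tclI I1] := comaximal_member a0 Fco FI tI.
have [[I0 _ IM] ID] := idI.
have {}I1 : ~ I 1 by apply: I1 => IE; apply: nI; right.
have [|M Mmax IsubM] := t_Max_exists Dmod D1 ID ((nonzeroP I0).1 nzI).
  by rewrite tclI.
(* No [f y] lies in [M], so each [y] in [Y] is [a] times an element of the localization. A common
   denominator gives [s] outside [M] with $s a^{-1} Y$ inside [D]. *)
have [|s [Ds Ms] sY] := inv_loc Dmod D1 Mmax (w := a^-1) finY.
  move=> y Yy; have [FJ [u uJ ->]] := hf y Yy; rewrite mulKf//.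
  have IJ : I <> f y by move=> IE; apply: nI; left; exists y.
  have nsub := comaximal_t_Max Dmod D1 Mmax (comaximal_pair a0 Fco FI FJ IJ).
  have [t Jt Mt] : exists2 t, f y t & ~ M t.
    apply: contrapT => nt; apply: nsub => x [/IsubM//|Jx].
    by apply: contrapT => Mx; apply: nt; exists x.
  apply/(locP Dmod D1 Mmax); exists t; last by rewrite mulrC; apply: uJ.
  by split=> //; case: Fco => + _ _ => /(_ _ FJ)[_]; apply.
(* The contradiction is that [s] lies in [I]. As [I] is $v$-closed, it suffices that [s * u] is in
   [D] for [u] in its inverse. This is the product of [a * u], in the $v$-closure of [Y], and $s
   a^{-1}$, in the inverse of [Y]. *)
apply: Ms; apply: IsubM.
have [Z [finZ ZI _ IZ]] := t_finite_t_ideal Dmod idI nzI tfI tI.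
rewrite IZ => u; rewrite -inv_v_closure -IZ => uI.
have Xau : X (a * u) by exists I, u.
have := XY _ (@sub_tcl _ D _ _ Xau) _ sY.
by rewrite mulrA -(mulrA a) mulrAC divff// mul1r mulrC.
Qed.

End Equivalence.

(** * The domain inside its quotient field, and the equivalence *)

Lemma submodule_dom_in_frac (A : idomainType) :
  submodule (dom_in_frac A) (dom_in_frac A).
Proof.
split; first by exists 0 => //; rewrite tofrac0.
  by move=> _ _ [x _ <-] [y _ <-]; exists (x + y) => //; rewrite tofracD.
by move=> _ _ [x _ <-] [y _ <-]; exists (x * y) => //; rewrite tofracM.
Qed.

Lemma dom_in_frac1 (A : idomainType) : dom_in_frac A 1.
Proof. by exists 1 => //; rewrite tofrac1. Qed.

Lemma dom_in_frac_denom (A : idomainType) (z : {fraction A}) :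
  exists2 s, dom_in_frac A s /\ s != 0 & dom_in_frac A (s * z).
Proof.
elim/quotW: z => x; exists (FracField.tofrac (frac x).2).
  by split; [exists (frac x).2|rewrite tofrac_eq0 denom_ratioP].
exists (frac x).1 => //; unlock FracField.tofrac; rewrite -[RHS]FracField.pi_mul.
apply/eqmodP; rewrite /= FracField.equivfE /FracField.mulf.
by rewrite !numden_Ratio ?mulf_neq0 ?oner_eq0 ?denom_ratioP// !mul1r mulrC.
Qed.

Theorem theorem1p11 (A : idomainType)
    (hA : t_locally_v_coherent (dom_in_frac A)) :
  [<-> t_finite_character (dom_in_frac A);
       forall (a : {fraction A}) (F : set (set {fraction A})),
         dom_in_frac A a -> a != 0 ->
         t_comaximal_over (dom_in_frac A) a F ->
         (forall I, F I -> t_finite (dom_in_frac A) I /\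
                           t_ideal (dom_in_frac A) I) ->
         finite_set F;
       forall I : set {fraction A},
         ideal (dom_in_frac A) I -> nonzero I ->
         t_locally_t_finite (dom_in_frac A) I ->
         t_finite (dom_in_frac A) I].
Proof.
have Amod := submodule_dom_in_frac A; have A1 := dom_in_frac1 A.
(* The cycle asks for (ii) -> (iii) and (iii) -> (i); each passes through (ii) -> (i). *)
have fin_of_comax : (forall a, dom_in_frac A a -> a != 0 ->
    comaximal_families_finite (dom_in_frac A) a) ->
    t_finite_character (dom_in_frac A).
  by move=> hco a Aa a0; apply: (finite_t_Max_over Amod A1 a0 (hco a Aa a0)).
tfae.
- move=> fchar a F Aa a0.
  exact: (comaximal_families_finite_of_character Amod A1 fchar Aa a0).
- move=> hco I; apply: (t_finite_of_character Amod A1).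
    by apply: fin_of_comax => a Aa a0 F; apply: hco.
  exact: dom_in_frac_denom.
- move=> hloc; apply: fin_of_comax => a Aa a0.
  exact: comaximal_families_finite_of_t_locally.
Qed.
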